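(* Let $F(w)=\mathbb{E}_{\xi\sim\mathbb{P}}[f_\xi(w)]$ be $(L_0,L_1,\alpha)$-generalized-smooth, and let the stochastic gradients $\nabla f_\xi$ be unbiased and satisfy the affine approximation error condition with parameters $(\tau_1,\tau_2)$, as defined in the context. Let $\beta\in[\alpha,1]$ with $\beta>0$, let $\epsilon>0$, and run the IAN-SGD algorithm (see context) for $T$ iterations from $w_0\in\mathbf{R}^d$ with $$\gamma=\min\left\{\frac{1}{4L_0(2\tau_1^2+1)},\ \frac{1}{4L_1(2\tau_1^2+1)},\ \frac{1}{\sqrt{T}},\ \frac{1}{8L_1(2\tau_1^2+1)\left(2\tau_2/(1-\tau_1)\right)^{\beta}}\right\},$$ $$A=\frac{1}{1-\tau_1},\qquad \delta=\frac{\tau_2}{1-\tau_1},\qquad \Gamma=\left(4L_1\gamma(2\tau_1^2+1)\right)^{1/\beta}.$$ Denote $\Lambda:=F(w_0)-F^*+\frac12(L_0+L_1)(1+4\tau_2^2)^2$. Then, with probability at least $\frac12$, IAN-SGD produces a sequence satisfying $\min_{t\le T}\|\nabla F(w_t)\|\le\epsilon$ provided that $$T\ge\Lambda\max\left\{\frac{256\Lambda}{\epsilon^4},\ \frac{64L_1(2\tau_1^2+1)(2+2\tau_1)^{\beta}}{(1-\tau_1)^{\beta}\epsilon^{2-\beta}},\ (2\tau_1^2+1)\cdot\frac{64(L_0+L_1)+128L_1\left(2\tau_2/(1-\tau_1)\right)^{\beta}}{\epsilon^2}\right\}.$$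
   Context: $\|\cdot\|$ is the Euclidean norm; $\mathbb{P}$ is the data distribution and $f_\xi:\mathbf{R}^d\to\mathbf{R}$ is the differentiable loss associated with sample $\xi$. Generalized-smooth: $F:\mathbf{R}^d\to\mathbf{R}$ is differentiable, $F^*:=\inf_{w}F(w)>-\infty$, and there are constants $L_0,L_1>0$, $\alpha\in[0,1]$ such that for all $w,w'\in\mathbf{R}^d$, $\|\nabla F(w)-\nabla F(w')\|\le(L_0+L_1\|\nabla F(w')\|^{\alpha})\|w-w'\|$. Unbiasedness: $\mathbb{E}_{\xi\sim\mathbb{P}}[\nabla f_\xi(w)]=\nabla F(w)$ for all $w\in\mathbf{R}^d$. Affine approximation error: there are $0\le\tau_1<1$ and $\tau_2>0$ such that for every $w\in\mathbf{R}^d$, $\|\nabla f_\xi(w)-\nabla F(w)\|\le\tau_1\|\nabla F(w)\|+\tau_2$ almost surely over $\xi\sim\mathbb{P}$. IAN-SGD: at each iteration $t$ draw two samples $\xi,\xi'\sim\mathbb{P}$, independent of each other and of the past, and set $$w_{t+1}=w_t-\gamma\frac{\nabla f_\xi(w_t)}{h_t^{\beta}},\qquad h_t=\max\left\{1,\ \Gamma\left(A\|\nabla f_{\xi'}(w_t)\|+\delta\right)\right\}.$$ *)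

(* Defs.v *)
From HB Require Import structures.
From mathcomp Require Export all_boot all_order all_algebra.
From mathcomp Require Export all_classical all_reals all_analysis.

Set Implicit Arguments.
Unset Strict Implicit.
Unset Printing Implicit Defensive.

Import Order.TTheory GRing.Theory Num.Theory.
Import numFieldNormedType.Exports.

Local Open Scope classical_set_scope.
Local Open Scope ring_scope.

(* The library norm on 'rV[R]_d is the sup norm. The two norms induce the same
   topology, so [differentiable] and ['D_v] below are the Euclidean notions. *)
Definition enorm (R : realType) (d : nat) (u : 'rV[R]_d) : R :=
  Num.sqrt (\sum_(i < d) u 0 i ^+ 2).

Definition grad (R : realType) (d : nat) (F : 'rV[R]_d -> R) (w : 'rV[R]_d) :
  'rV[R]_d := \row_(i < d) 'D_(delta_mx 0 i) F w.

(* In case alpha = 0 the factor is L0 + L1, because x `^ 0 = 1 even at x = 0. *)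
Definition generalized_smooth (R : realType) (d : nat) (F : 'rV[R]_d -> R)
    (L0 L1 alpha : R) : Prop :=
  [/\ forall w, differentiable F w,
      has_lbound (range F),
      0 < L0 /\ 0 < L1,
      0 <= alpha <= 1
    & forall w w', enorm (grad F w - grad F w') <=
        (L0 + L1 * enorm (grad F w') `^ alpha) * enorm (w - w')].

Definition has_expectation (R : realType) (dXi : measure_display)
    (Xi : measurableType dXi) (P : probability Xi R) (X : Xi -> R) (m : R) : Prop :=
  P.-integrable setT (EFin \o X) /\ ('E_P[X] = m%:E)%E.

Definition unbiased_gradient (R : realType) (d : nat) (dXi : measure_display)
    (Xi : measurableType dXi) (P : probability Xi R) (f : Xi -> 'rV[R]_d -> R)
    (F : 'rV[R]_d -> R) : Prop :=
  forall (w : 'rV[R]_d) (i : 'I_d),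
    has_expectation P (fun xi => grad (f xi) w 0 i) (grad F w 0 i).

Definition affine_approx_error (R : realType) (d : nat) (dXi : measure_display)
    (Xi : measurableType dXi) (P : probability Xi R) (f : Xi -> 'rV[R]_d -> R)
    (F : 'rV[R]_d -> R) (tau1 tau2 : R) : Prop :=
  [/\ 0 <= tau1 < 1, 0 < tau2
    & forall w : 'rV[R]_d, {ae P, forall xi,
        enorm (grad (f xi) w - grad F w) <= tau1 * enorm (grad F w) + tau2}].

Definition mutually_independent (R : realType) (dO dXi : measure_display)
    (Omega : measurableType dO) (Xi : measurableType dXi)
    (Pr : probability Omega R) (I : finType) (X : I -> {RV Pr >-> Xi}) : Prop :=
  forall (J : {set I}) (B : I -> set Xi), (forall i, measurable (B i)) ->
    Pr (\bigcap_(i in [set` J]) (X i @^-1` B i)) =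
    (\prod_(i in J) Pr (X i @^-1` B i))%E.

(* The samples xi t, xi' t used at the iterations t < T: all 2T of them are
   mutually independent with law P. Since w_0 is deterministic and w_t is a
   function of the earlier samples, this is independence of xi t and xi' t from
   each other and from the past. *)
Definition iid_sample_pairs (R : realType) (dO dXi : measure_display)
    (Omega : measurableType dO) (Xi : measurableType dXi)
    (Pr : probability Omega R) (P : probability Xi R) (T : nat)
    (xi xi' : nat -> {RV Pr >-> Xi}) : Prop :=
  [/\ forall t, (t < T)%N -> forall B, measurable B ->
        distribution Pr (xi t) B = P B,
      forall t, (t < T)%N -> forall B, measurable B ->
        distribution Pr (xi' t) B = P B
    & mutually_independent (fun i : 'I_T * bool =>
        if i.2 then xi' i.1 else xi i.1)].

Definition ian_sgd_step (R : realType) (d : nat) (Xi : Type)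
    (f : Xi -> 'rV[R]_d -> R) (gamma beta A delta Gamma : R)
    (w : 'rV[R]_d) (x x' : Xi) : 'rV[R]_d :=
  let h := Num.max 1 (Gamma * (A * enorm (grad (f x') w) + delta)) in
  w - (gamma / h `^ beta) *: grad (f x) w.

Fixpoint ian_sgd (R : realType) (d : nat) (Xi : Type)
    (f : Xi -> 'rV[R]_d -> R) (gamma beta A delta Gamma : R)
    (w0 : 'rV[R]_d) (x x' : nat -> Xi) (t : nat) : 'rV[R]_d :=
  if t is t'.+1 then
    ian_sgd_step f gamma beta A delta Gamma
      (ian_sgd f gamma beta A delta Gamma w0 x x' t') (x t') (x' t')
  else w0.

(* Main.v *)
Require Import Defs.
From HB Require Import structures.
From mathcomp Require Import all_boot all_order all_algebra.
From mathcomp Require Import all_classical all_reals all_analysis.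
From mathcomp Require Import measurable_realfun ring lra.
Import Order.TTheory GRing.Theory Num.Theory.
Import numFieldNormedType.Exports.
Local Open Scope classical_set_scope.
Local Open Scope ring_scope.

Set Implicit Arguments.
Unset Strict Implicit.
Unset Printing Implicit Defensive.

(* The potential F(w_t) - F^* decreases in expectation. Given w = w_t, write
   g = grad F(w), H = h_t^beta and a = gamma / H. The descent lemma, with
   L = L0 + L1 |g|^alpha, and the pointwise bound
   |n|^2 <= (tau1 |g| + tau2)^2 + 2 <g, n> - |g|^2 for n = grad f_xi(w) give
   E F(w - a n) <= F(w) - a |g|^2 + a^2 L / 2 (|g|^2 + (tau1 |g| + tau2)^2).
   The normalizer is at least 4 L1 gamma (2 tau1^2 + 1) |g|^beta, which makes
   the right-hand side at most
   F(w) - a |g|^2 / 4 + (L0 + L1) (1 + 4 tau2^2)^2 gamma^2 / 2.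
   The upper bound on the normalizer and the bound on T show
   a |g|^2 >= 8 Lambda / T as soon as |g| > epsilon. Summing over t < T, with
   T gamma^2 <= 1, bounds 2 Lambda Pr(all |grad F(w_t)| > epsilon) by Lambda. *)

(** * Independent families *)

Section independence.
Context (R : realType) (dO dXi : measure_display)
  (Omega : measurableType dO) (Xi : measurableType dXi)
  (Pr : probability Omega R) (I : finType) (X : I -> {RV Pr >-> Xi}).

(** These sets form a pi-system generating the sigma-algebra of the samples with index in [J]. [B]
    is indexed by all of [I], as in [mutually_independent], so intersections are taken slot by
    slot. *)
Definition cylinders (J : {set I}) : set (set Omega) :=
  [set A | exists2 B : I -> set Xi, (forall i, measurable (B i)) &
    A = \bigcap_(i in [set` J]) (X i @^-1` B i)].

(** [Omega] with a smaller sigma-algebra: being a function of the samples in [J] becomes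
    measurability on this type. *)
Definition sigma_of (J : {set I}) : measurableType (sigma_display (cylinders J))
  := g_sigma_algebraType (cylinders J).

Lemma cylinders_measurable (J : {set I}) : cylinders J `<=` measurable.
Proof.
move=> _ [B mB ->]; apply: fin_bigcap_measurable => // i _.
exact: measurable_funPTI.
Qed.

Lemma sigma_of_sub (J : {set I}) (A : set Omega) :
  measurable (A : set (sigma_of J)) -> measurable A.
Proof.
exact: (smallest_sub (@sigma_algebra_measurable _ Omega)
  (@cylinders_measurable J)).
Qed.

Lemma measurable_to_sigma_of (J : {set I}) :
  measurable_fun setT (id : Omega -> sigma_of J).
Proof. by move=> _ A mA; rewrite setTI; apply: (@sigma_of_sub J). Qed.

Lemma cylindersI (J : {set I}) : setI_closed (cylinders J).
Proof.
move=> _ _ [B mB ->] [C mC ->]; exists (fun i => B i `&` C i).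
  by move=> i; apply: measurableI.
by rewrite -bigcapI.
Qed.

Lemma cylindersT (J : {set I}) : cylinders J setT.
Proof.
by exists (fun=> setT) => //; apply/esym/seteqP; split.
Qed.

Lemma measurable_fun_sigma_of (J : {set I}) (i : I) : i \in J ->
  measurable_fun setT (X i : sigma_of J -> Xi).
Proof.
move=> iJ _ B mB; rewrite setTI; apply: sub_sigma_algebra.
exists (fun j => if j == i then B else setT) => [j|]; first by case: ifP.
apply/seteqP; split=> [y yB j /= _|y /(_ i iJ)]; last first.
  by rewrite /= eqxx.
by case: eqP => // ->.
Qed.

Hypothesis indep : mutually_independent X.

(** For fixed [B] both sides are finite measures in [A]. They agree on the pi-system [cylinders J],
    by independence over [J] and over [k |: J], hence on the sigma-algebra it generates. *)
Lemma sigma_of_indep (J : {set I}) (k : I) (A : set Omega) (B : set Xi) :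
  k \notin J -> measurable (A : set (sigma_of J)) -> measurable B ->
  (Pr (A `&` X k @^-1` B) = Pr A * Pr (X k @^-1` B))%E.
Proof.
move=> kJ mA mB.
have mXB : measurable (X k @^-1` B) by exact: measurable_funPTI.
set p := Pr (X k @^-1` B).
have p0 : (0 <= fine p)%R by apply: fine_ge0; exact: measure_ge0.
have pE : p = (fine p)%:E by rewrite fineK // fin_num_measure.
pose m2 := mscale (NngNum p0) Pr.
have key : mrestr Pr mXB A = m2 A.
  apply: (g_sigma_algebra_measure_unique (cylinders J) _ (fun=> setT)) => //.
  - exact: cylinders_measurable.
  - by move=> ?; exact: cylindersT.
  - by apply/seteqP; split => // x _; exists 0%N.
  - exact: cylindersI.
  - move=> _ [C mC ->]; rewrite /mrestr/= /m2 /mscale /= -pE.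
    have := @indep (k |: J) (fun i => if i == k then B else C i).
    rewrite big_setU1 //= eqxx (_ : \bigcap_(i in _) _ =
       \bigcap_(i in [set` J]) X i @^-1` C i `&` X k @^-1` B); last first.
      apply/seteqP; split=> y.
        move=> H; split=> [i /= iJ|].
          have := H i; rewrite /= !inE iJ orbT => /(_ isT).
          by case: eqP => // ik; move: kJ; rewrite -ik iJ.
        by have := H k; rewrite /= !inE !eqxx; exact.
      move=> [H1 H2] i /=; rewrite !inE => /orP[/eqP ->|iJ].
        by rewrite eqxx.
      by case: eqP => [->//|_]; exact: H1.
    move=> H; apply: etrans; first by apply: H => i; case: ifP.
    rewrite -/p; congr (_ * _)%E; rewrite (@indep J C) //.
    apply: eq_bigr => i iJ.
    by case: eqP => // ik; move: kJ; rewrite -ik iJ.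
  - by move=> ?; rewrite /= /mrestr setTI -ge0_fin_numE// fin_num_measure.
by move: key; rewrite /mrestr /m2/= /mscale/= -pE muleC.
Qed.

(** Freezing lemma: a sample outside [J] may be averaged under its law [P] while everything that
    depends on [J] is held fixed. By [sigma_of_indep] on rectangles, the joint law is a product
    measure, and Tonelli applies. *)
Lemma integral_indep (J : {set I}) (k : I) (P : probability Xi R)
    (U : sigma_of J * Xi -> \bar R) : k \notin J ->
  (forall B, measurable B -> distribution Pr (X k) B = P B) ->
  measurable_fun setT U -> (forall z, 0 <= U z)%E ->
  (\int[Pr]_o U (o, X k o) = \int[Pr]_o \int[P]_x U (o, x))%E.
Proof.
move=> kJ lawk mU U0.
have mpair : measurable_fun [set: Omega] (fun o => (o : sigma_of J, X k o)).
  apply: (@measurable_fun_pair _ _ _ Omega (sigma_of J) Xi) => //.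
  exact: measurable_to_sigma_of.
(* The law of the identity, as a map into [sigma_of J], is the restriction of [Pr] to that
   sigma-algebra, the first factor of the product. *)
pose idRV : {RV Pr >-> sigma_of J} :=
  HB.pack (id : Omega -> sigma_of J)
    (isMeasurableFun.Build _ _ _ _ _ (@measurable_to_sigma_of J)).
pose pairRV : {RV Pr >-> (sigma_of J * Xi)%type} :=
  HB.pack (fun o : Omega => (o : sigma_of J, X k o))
    (isMeasurableFun.Build _ _ _ _ _ mpair).
have := @ge0_integral_distribution _ _ _ _ _ _ pairRV _ mU U0.
move=> /= <-.
have mF := @measurable_fun_fubini_tonelli_F _ _ _ _ _ P _ mU U0.
have := @ge0_integral_distribution _ _ _ _ _ _ idRV _ mF.
rewrite /= => <-; last by move=> y; apply: integral_ge0.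
rewrite -fubini_tonelli1 //.
apply: eq_measure_integral => A mA _.
apply/esym/product_measure_unique => // C D mC mD.
have := sigma_of_indep kJ mC mD.
by rewrite (lawk D mD : Pr (X k @^-1` D) = P D).
Qed.
End independence.

(** * Measurability of gradients *)

Section row_limits.
Context {R : realType} {d : nat}.

Lemma cvg_row (u : nat -> 'rV[R]_d) (v : 'rV[R]_d) :
  (forall i, u n 0 i @[n --> \oo] --> v 0 i) -> u n @[n --> \oo] --> v.
Proof.
move=> uv; apply/cvg_ballP => e e0.
have : \forall n \near \oo, forall i, ball (v 0 i) e (u n 0 i).
  by apply: filter_forall => i; apply: cvg_ball (uv i) _ e0.
by apply: filterS => n vu; split => // i j; rewrite ord1; exact: vu.
Qed.

Lemma cvg_floor_div (x : R) :
  (Num.floor (n.+1%:R * x))%:~R / n.+1%:R @[n --> \oo] --> x.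
Proof.
apply: (@squeeze_cvgr _ _ _ _ (fun n => x - n.+1%:R^-1) (cst x)).
- near=> n.
  have n0 : (0 : R) < n.+1%:R by [].
  have := floor_itv (n.+1%:R * x); rewrite intrD => /andP[h1 h2].
  rewrite /= ler_pdivrMr // ler_pdivlMr // (mulrC x) h1 andbT.
  by rewrite mulrBl mulVf ?gt_eqF// lerBlDr (mulrC x) ltW.
- rewrite -[X in _ --> X]subr0.
  by apply: cvgB; [exact: cvg_cst|exact: cvg_harmonic].
- exact: cvg_cst.
Unshelve. all: by end_near. Qed.

(** The points [1 / (n+1)] tend to zero without reaching it, so a derivative is the limit of a
    sequence of difference quotients; such limits preserve measurability. *)
Lemma cvg_harmonic_dnbhs : n.+1%:R^-1 @[n --> \oo] --> (0 : R)^'.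
Proof.
move=> A [e /= e0 eA].
have : \forall n \near \oo, ball (0 : R) e n.+1%:R^-1.
  exact: (cvg_harmonic (nbhsx_ballx (0 : R) e e0)).
by apply: filterS => n ne; apply: eA.
Qed.
End row_limits.

Section measurability.
Context {R : realType} {d : nat} {dXi dO : measure_display}
  {Xi : measurableType dXi} {Om : measurableType dO}.

(* W is approximated by the grid points floor((n+1) W) / (n+1), which take
   countably many values. *)
Lemma measurable_caratheodory (g : Xi -> 'rV[R]_d -> R)
    (X : Om -> Xi) (W : Om -> 'rV[R]_d) :
  (forall w, measurable_fun setT (g^~ w)) -> (forall x, continuous (g x)) ->
  measurable_fun setT X -> (forall i, measurable_fun setT (fun y => W y 0 i)) ->
  measurable_fun setT (fun y => g (X y) (W y)).
Proof.
move=> mg cg mX mW.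
pose q n y : 'rV[int]_d := \row_i Num.floor (n.+1%:R * W y 0 i).
pose r n (z : 'rV[int]_d) : 'rV[R]_d := \row_i ((z 0 i)%:~R / n.+1%:R).
apply: (@measurable_fun_cvg _ _ _ _ (fun n y => g (X y) (r n (q n y)))).
  move=> n _ B mB; rewrite setTI.
  (* The preimage splits over the countably many grid points [z]; for fixed [z] only a section of
     [g] composed with [X] remains. *)
  rewrite (_ : _ @^-1` B = \bigcup_(z : 'rV[int]_d)
      (q n @^-1` [set z] `&` X @^-1` (g^~ (r n z) @^-1` B))); last first.
    apply/seteqP; split=> [y By|y [z _ [<- //]]].
    by exists (q n y).
  apply: countable_bigcupT_measurable => [|z]; first exact: countableP.
  apply: measurableI; last first.
    by rewrite -[X in measurable X]setTI; apply: mX => //;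
       rewrite -[X in measurable X]setTI; exact: mg.
  (* The points rounded to [z] form a box of half-open intervals. *)
  rewrite (_ : _ @^-1` _ = \bigcap_(i in [set: 'I_d])
      (fun y => n.+1%:R * W y 0 i) @^-1` `[(z 0 i)%:~R, (z 0 i + 1)%:~R[); last first.
    apply/seteqP; split=> [y <- i _|y yz].
      by rewrite /= in_itv /= mxE floor_itv.
    apply/rowP => i; rewrite mxE; apply: floor_def.
    by have := yz i I; rewrite /= in_itv.
  apply: fin_bigcap_measurable => // i _; rewrite -[X in measurable X]setTI.
  by apply: measurable_funM => //; exact: measurable_cst.
move=> y _; apply: (cvg_comp (fun n => r n (q n y)) (g (X y)) _ (cg _ _)).
apply: cvg_row => i.
under eq_fun do rewrite !mxE.
exact: cvg_floor_div.
Qed.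

(** A partial derivative is a limit of difference quotients with increments [1 / (n+1)]. Each
    quotient is measurable by [measurable_caratheodory], as differentiability gives continuity in
    [w]. *)
Lemma measurable_grad (f : Xi -> 'rV[R]_d -> R)
    (X : Om -> Xi) (W : Om -> 'rV[R]_d) (i : 'I_d) :
  (forall w, measurable_fun setT (f^~ w)) ->
  (forall x w, differentiable (f x) w) ->
  measurable_fun setT X -> (forall i, measurable_fun setT (fun y => W y 0 i)) ->
  measurable_fun setT (fun y => grad (f (X y)) (W y) 0 i).
Proof.
move=> mf df mX mW.
have cf x : continuous (f x) by move=> w; exact: differentiable_continuous.
apply: (@measurable_fun_cvg _ _ _ _ (fun n y =>
  n.+1%:R^-1^-1 * (f (X y) (n.+1%:R^-1 *: delta_mx 0 i + W y) - f (X y) (W y)))).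
  move=> n; apply: measurable_funM; first exact: measurable_cst.
  apply: measurable_funB; last exact: measurable_caratheodory.
  apply: measurable_caratheodory => // j.
  under eq_fun do rewrite mxE.
  by apply: measurable_funD => //; exact: measurable_cst.
move=> y _; rewrite mxE.
have := @diff_derivable _ _ _ (f (X y)) (W y) (delta_mx 0 i) (df _ _).
move=> /(cvg_comp _ _ cvg_harmonic_dnbhs); exact.
Qed.

Lemma measurable_enorm (W : Om -> 'rV[R]_d) :
  (forall i, measurable_fun setT (fun y => W y 0 i)) ->
  measurable_fun setT (fun y => enorm (W y)).
Proof.
move=> mW; have msqrt : measurable_fun setT (@Num.sqrt R).
  apply: continuous_measurable_fun.
  exact: sqrt_continuous.
apply: (measurableT_comp msqrt).
by apply: measurable_sum => i; exact: measurable_funX.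
Qed.
End measurability.

(** * Euclidean norm and descent lemma *)

Section euclidean.
Context {R : realType} {d : nat}.
Implicit Types (u v w : 'rV[R]_d) (a : R).

Definition dotr u v : R := \sum_(i < d) u 0 i * v 0 i.

Lemma dotrC u v : dotr u v = dotr v u.
Proof. by apply: eq_bigr => i _; rewrite mulrC. Qed.

Lemma dotrDl u v w : dotr (u + v) w = dotr u w + dotr v w.
Proof. by rewrite -big_split; apply: eq_bigr => i _; rewrite mxE mulrDl. Qed.

Lemma dotrZl a u v : dotr (a *: u) v = a * dotr u v.
Proof. by rewrite mulr_sumr; apply: eq_bigr => i _; rewrite mxE mulrA. Qed.

Lemma dotrNl u v : dotr (- u) v = - dotr u v.
Proof. by rewrite -scaleN1r dotrZl mulN1r. Qed.

Lemma dotrDr u v w : dotr w (u + v) = dotr w u + dotr w v.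
Proof. by rewrite dotrC dotrDl !(dotrC w). Qed.

Lemma dotrZr a u v : dotr u (a *: v) = a * dotr u v.
Proof. by rewrite dotrC dotrZl dotrC. Qed.

Lemma dotrNr u v : dotr u (- v) = - dotr u v.
Proof. by rewrite dotrC dotrNl dotrC. Qed.

Definition dotrE := (dotrDl, dotrDr, dotrNl, dotrNr, dotrZl, dotrZr).

Lemma dotrr_ge0 u : 0 <= dotr u u.
Proof. by apply: sumr_ge0 => i _; rewrite -expr2 sqr_ge0. Qed.

Lemma enorm_ge0 u : 0 <= enorm u. Proof. exact: sqrtr_ge0. Qed.

Lemma enormE u : enorm u = Num.sqrt (dotr u u).
Proof. by congr Num.sqrt; apply: eq_bigr => i _; rewrite expr2. Qed.

Lemma sqr_enorm u : enorm u ^+ 2 = dotr u u.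
Proof. by rewrite enormE sqr_sqrtr // dotrr_ge0. Qed.

Lemma enormZ a u : enorm (a *: u) = `|a| * enorm u.
Proof.
by rewrite !enormE !dotrE mulrA -expr2 sqrtrM ?sqr_ge0 // sqrtr_sqr.
Qed.

Lemma enormN u : enorm (- u) = enorm u.
Proof. by rewrite -scaleN1r enormZ normrN1 mul1r. Qed.

(** Cauchy-Schwarz: expand the square of [enorm v *: u - enorm u *: v] and divide by
    [enorm u * enorm v], after settling the case of a zero norm. *)
Lemma dotr_le_enorm u v : dotr u v <= enorm u * enorm v.
Proof.
have := dotrr_ge0 (enorm v *: u - enorm u *: v).
rewrite !dotrE -!sqr_enorm (dotrC v u).
have dotr0 (x : 'rV[R]_d) : enorm x = 0 -> forall i, x 0 i = 0.
  move=> x0 i; have /eqP : dotr x x = 0 by rewrite -sqr_enorm x0 expr0n.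
  rewrite psumr_eq0 => [/allP/(_ i)|j _]; last by rewrite -expr2 sqr_ge0.
  by rewrite mem_index_enum mulf_eq0 orbb => /(_ isT)/eqP.
have [/dotr0 u0 _|u0] := eqVneq (enorm u) 0.
  by rewrite [X in X <= _]big1 ?mulr_ge0 ?enorm_ge0 // => i _; rewrite u0 mul0r.
have [/dotr0 v0 _|v0] := eqVneq (enorm v) 0.
  by rewrite [X in X <= _]big1 ?mulr_ge0 ?enorm_ge0 // => i _; rewrite v0 mulr0.
have {}u0 : 0 < enorm u by rewrite lt_def u0 enorm_ge0.
have {}v0 : 0 < enorm v by rewrite lt_def v0 enorm_ge0.
move=> h; rewrite -(ler_pM2l (mulr_gt0 u0 v0)).
move: h; lra.
Qed.

Lemma ler_enormD u v : enorm (u + v) <= enorm u + enorm v.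
Proof.
rewrite -(@ler_pXn2r _ 2) ?nnegrE ?addr_ge0 ?enorm_ge0 //.
rewrite sqrrD !sqr_enorm !dotrE (dotrC v u).
have := dotr_le_enorm u v; lra.
Qed.

Lemma ler_enormB u v : enorm u - enorm v <= enorm (u - v).
Proof. by rewrite lerBlDr -{1}(subrK v u) ler_enormD. Qed.
End euclidean.

Section descent.
Context {R : realType} {d : nat} (F : 'rV[R]_d -> R).
Hypothesis dF : forall w, differentiable F w.

Lemma derive_grad (w v : 'rV[R]_d) : 'D_v F w = dotr (grad F w) v.
Proof.
rewrite deriveE // {1}(row_sum_delta v) linear_sum; apply: eq_bigr => i _.
by rewrite linearZ mxE deriveE // mulrC.
Qed.

Lemma is_derive_line (w v : 'rV[R]_d) (s : R) :
  is_derive s 1 (fun t : R => F (w + t *: v)) (dotr (grad F (w + s *: v)) v).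
Proof.
have E : (fun h : R => h^-1 *: (F (w + (h *: 1 + s) *: v) - F (w + s *: v))) =
    (fun h => h^-1 *: (F (h *: v + (w + s *: v)) - F (w + s *: v))).
  apply/funext => h; congr (_ *: (F _ - _)).
  by rewrite [h *: 1]mulr1 scalerDl addrCA.
split; last by rewrite -derive_grad /derive /= E.
rewrite /derivable /= E.
exact: (@diff_derivable _ _ _ F (w + s *: v) v).
Qed.

(* Only the Lipschitz bound centered at w is available, so the derivative of t |->
   F (w + t v) is compared with its value at 0 rather than between two points. *)
Lemma descent_lemma (L : R) (w v : 'rV[R]_d) :
  (forall w', enorm (grad F w' - grad F w) <= L * enorm (w' - w)) ->
  F (w + v) <= F w + dotr (grad F w) v + L / 2 * enorm v ^+ 2.
Proof.
move=> lipL.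
(* [psi] is [F] minus its quadratic upper model along the segment, up to a constant. The claim is
   [psi 1 <= psi 0], which the mean value theorem reduces to [dpsi c <= 0]. *)
pose psi (t : R) := F (w + t *: v) - t * dotr (grad F w) v
  - t ^+ 2 * (L / 2 * enorm v ^+ 2).
pose dpsi (t : R) := dotr (grad F (w + t *: v)) v - dotr (grad F w) v
  - 2 * t * (L / 2 * enorm v ^+ 2).
have psi' (t : R) : is_derive t 1 psi (dpsi t).
  have D1 := is_derive_line w v t.
  rewrite /psi; apply: is_derive_eq.
  rewrite /dpsi /GRing.scale /= !mulr0 !add0r.
  ring.
have cpsi (t : R) : {for t, continuous psi}.
  apply: differentiable_continuous; apply/derivable1_diffP.
  exact: ex_derive.
have [c c01 psiE] := @MVT _ psi dpsi 0 1 ltr01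
  (fun x _ => psi' x) (continuous_subspaceT cpsi).
suff : dpsi c <= 0.
  move: psiE; rewrite /psi scale1r scale0r !addr0 expr1n expr0n /= => E H.
  by move: E H; nra.
move: c01; rewrite in_itv /= => /andP[c0 _].
(* The gradient varies by at most [L * c * enorm v]; by Cauchy-Schwarz its product with [v] is at
   most [L * c * enorm v ^+ 2], the term subtracted in [dpsi c]. *)
have := lipL (w + c *: v).
rewrite (addrC w) addrK enormZ gtr0_norm // => H.
have := dotr_le_enorm (grad F (c *: v + w) - grad F w) v.
rewrite dotrDl dotrNl addrC /dpsi (addrC w) => H2.
have := ler_wpM2r (enorm_ge0 v) H.
lra.
Qed.
End descent.

(** * Step size and normalizer *)

Section scalar_inequalities.
Context {R : realType}.

Lemma powR_le1 (x r : R) : 0 <= x <= 1 -> 0 <= r -> x `^ r <= 1.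
Proof.
move=> /andP[x0 x1] r0; apply: (@le_trans _ _ (1 `^ r)); last by rewrite powR1.
by rewrite ge0_ler_powR // nnegrE.
Qed.

(** On [[0, 1]] the left side is at most 1, and beyond 1 powers increase with the exponent. This
    trades the smoothness exponent [alpha] for [beta] or for 1. *)
Lemma powR_le_add1 (x r s : R) : 0 <= x -> 0 <= r <= s -> x `^ r <= 1 + x `^ s.
Proof.
move=> x0 /andP[r0 rs]; have [x1|x1] := leP x 1.
  by rewrite (le_trans (powR_le1 _ r0)) ?x0 // lerDl powR_ge0.
by rewrite (le_trans (ler_powR (ltW x1) rs)) // lerDr.
Qed.

(** The quadratic term is paid for by two shares of three eighths of the descent
    [gamma / H * G ^+ 2], which leaves one quarter of it; only for small [G] does a remainder of
    order [gamma ^+ 2] appear. *)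
Lemma step_decrease (L0 L1 tau1 tau2 gamma alpha beta G H : R) :
  0 < L0 -> 0 < L1 -> 0 <= tau1 -> 0 <= alpha <= beta -> beta <= 1 ->
  0 < gamma -> gamma <= 1 / (4 * L0 * (2 * tau1 ^+ 2 + 1)) ->
  gamma <= 1 / (4 * L1 * (2 * tau1 ^+ 2 + 1)) ->
  0 <= G -> 1 <= H -> 4 * L1 * gamma * (2 * tau1 ^+ 2 + 1) * G `^ beta <= H ->
  - (gamma / H * G ^+ 2) + (gamma / H) ^+ 2 * (L0 + L1 * G `^ alpha) / 2 *
      (G ^+ 2 + (tau1 * G + tau2) ^+ 2) <=
  - (gamma / H * G ^+ 2) / 4 +
    1 / 2 * (L0 + L1) * (1 + 4 * tau2 ^+ 2) ^+ 2 * gamma ^+ 2.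
Proof.
move=> L0_gt0 L1_gt0 t1 ab b1 g0 gL0 gL1 G0 H1 HG.
set c := 2 * tau1 ^+ 2 + 1 in gL0 gL1 HG *.
have c1 : 1 <= c by rewrite lerDr mulr_ge0 // sqr_ge0.
have c0 : 0 < c by exact: lt_le_trans c1.
have H0 : 0 < H by exact: lt_le_trans H1.
move: gL0 gL1; rewrite !ler_pdivlMr ?mulr_gt0 // => gL0 gL1.
set a := gamma / H; have a0 : 0 < a by rewrite divr_gt0.
have aH : a * H = gamma by rewrite /a divfK // gt_eqF.
have ag : a <= gamma by rewrite -aH ler_peMr // ltW.
have Ga_ge0 : 0 <= G `^ alpha by exact: powR_ge0.
(* Two bounds on the curvature: one with G^beta, to meet the normalizer, and one linear in [G], for
   small gradients. *)
have Ga_b : G `^ alpha <= 1 + G `^ beta by exact: powR_le_add1.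
have Ga_1 : G `^ alpha <= 1 + G.
  rewrite -[X in 1 + X]powRr1 //; apply: powR_le_add1 => //.
  by case/andP: ab => -> /=; move/le_trans; exact.
set Ga := G `^ alpha in Ga_ge0 Ga_b Ga_1 *; set Gb := G `^ beta in HG Ga_b.
set L := L0 + L1 * Ga.
have L_gt0 : 0 < L by rewrite ltr_wpDr // mulr_ge0 // ltW.
(* The step size absorbs the curvature: [a L c <= 3/4]. *)
have aLc : a * L * c <= 3 / 4.
  rewrite -(ler_pM2r H0) [a * L * c * H](_ : _ = gamma * L * c); last first.
    by rewrite -aH; ring.
  have gL1c : 0 <= gamma * L1 * c by rewrite !mulr_ge0 // ltW.
  (* Of the three quarters of [H], one comes from [gamma * L0 * c <= 1/4], one from
     [gamma * L1 * c <= 1/4], both with [1 <= H], and one from the lower bound on the normalizer. *)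
  have := ler_wpM2l gL1c Ga_b.
  rewrite /L; lra.
(* Splitting the square by [(x + y)^2 <= 2 x^2 + 2 y^2] produces the factor [c]. *)
have nsq : G ^+ 2 + (tau1 * G + tau2) ^+ 2 <= c * G ^+ 2 + 2 * tau2 ^+ 2.
  rewrite /c; have := sqr_ge0 (tau1 * G - tau2); lra.
have step1 : a ^+ 2 * L / 2 * (G ^+ 2 + (tau1 * G + tau2) ^+ 2) <=
    3 / 8 * (a * G ^+ 2) + a ^+ 2 * L * tau2 ^+ 2.
  apply: le_trans (ler_wpM2l _ nsq) _.
    by rewrite divr_ge0 // mulr_ge0 ?sqr_ge0 // ltW.
  have aG0 : 0 <= a * G ^+ 2 by rewrite mulr_ge0 ?sqr_ge0 // ltW.
  have := ler_wpM2r aG0 aLc.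
  lra.
have step2 : a ^+ 2 * L * tau2 ^+ 2 <= 3 / 8 * (a * G ^+ 2) +
    1 / 2 * (L0 + L1) * (1 + 4 * tau2 ^+ 2) ^+ 2 * gamma ^+ 2.
  have t2 := sqr_ge0 tau2.
  have C0 : 0 <= 1 / 2 * (L0 + L1) * (1 + 4 * tau2 ^+ 2) ^+ 2 * gamma ^+ 2.
    by do 2 (apply: mulr_ge0; last exact: sqr_ge0); lra.
  (* If the gradient dominates the noise, the descent term absorbs the remainder; otherwise [G],
     hence [L], is bounded in terms of [tau2], and [a <= gamma] gives a term of order
     [gamma ^+ 2]. *)
  have [Gbig|Gsmall] := leP (2 * tau2 ^+ 2) (G ^+ 2).
    have aL : a * L <= 3 / 4.
      by rewrite (le_trans _ aLc) // ler_peMr // mulr_ge0 // ltW.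
    have h1 : a * L * (a * tau2 ^+ 2) <= 3 / 4 * (a * tau2 ^+ 2).
      by apply: ler_wpM2r => //; rewrite mulr_ge0 // ltW.
    have := ler_wpM2l (ltW a0) Gbig.
    lra.
  have Ga2 : Ga <= 3 / 2 + tau2 ^+ 2.
    have := sqr_ge0 (G - 1); lra.
  have aG0 : 0 <= a * G ^+ 2 by rewrite mulr_ge0 ?sqr_ge0 // ltW.
  have a2 : a ^+ 2 <= gamma ^+ 2 by rewrite ler_sqr ?nnegrE // ltW.
  have LL : L <= (L0 + L1) * (3 / 2 + tau2 ^+ 2).
    have h1 := ler_wpM2l (ltW L1_gt0) Ga2.
    have h2 : 0 <= L0 * tau2 ^+ 2 by rewrite mulr_ge0 // ltW.
    rewrite /L; lra.
  have h1 : a ^+ 2 * (L * tau2 ^+ 2) <= gamma ^+ 2 * (L * tau2 ^+ 2).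
    by apply: ler_wpM2r => //; rewrite mulr_ge0 // ltW.
  have h2 : gamma ^+ 2 * (L * tau2 ^+ 2) <=
      gamma ^+ 2 * ((L0 + L1) * (3 / 2 + tau2 ^+ 2) * tau2 ^+ 2).
    by apply: ler_wpM2l; [exact: sqr_ge0|exact: ler_wpM2r].
  have h3 : (3 / 2 + tau2 ^+ 2) * tau2 ^+ 2 <= 1 / 2 * (1 + 4 * tau2 ^+ 2) ^+ 2.
    have := sqr_ge0 (tau2 ^+ 2); lra.
  have h4 : gamma ^+ 2 * (L0 + L1) * ((3 / 2 + tau2 ^+ 2) * tau2 ^+ 2) <=
      gamma ^+ 2 * (L0 + L1) * (1 / 2 * (1 + 4 * tau2 ^+ 2) ^+ 2).
    by apply: ler_wpM2l => //; rewrite mulr_ge0 ?sqr_ge0 // addr_ge0 // ltW.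
  lra.
lra.
Qed.

(** When [H <= 1] the step is at least [gamma], and the bound on [T] makes each of the four
    candidates for [gamma] large enough. Otherwise [H] is at most a multiple of [gamma], so
    [gamma / H] has a lower bound free of [gamma], and the middle term of the bound on [T]
    applies. *)
Lemma step_progress (L0 L1 tau1 tau2 gamma beta epsilon Lambda G H T : R) :
  0 < L0 -> 0 < L1 -> 0 <= tau1 < 1 -> 0 < tau2 -> 0 < beta <= 1 ->
  0 < epsilon -> 0 < Lambda -> 0 < T ->
  gamma = Num.min (1 / (4 * L0 * (2 * tau1 ^+ 2 + 1)))
    (Num.min (1 / (4 * L1 * (2 * tau1 ^+ 2 + 1)))
    (Num.min (1 / Num.sqrt T)
             (1 / (8 * L1 * (2 * tau1 ^+ 2 + 1) *
                   (2 * tau2 / (1 - tau1)) `^ beta)))) ->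
  Lambda *
     Num.max (256 * Lambda / epsilon ^+ 4)
    (Num.max (64 * L1 * (2 * tau1 ^+ 2 + 1) * (2 + 2 * tau1) `^ beta /
                ((1 - tau1) `^ beta * epsilon `^ (2 - beta)))
             ((2 * tau1 ^+ 2 + 1) *
                ((64 * (L0 + L1) + 128 * L1 * (2 * tau2 / (1 - tau1)) `^ beta) /
                 epsilon ^+ 2))) <= T ->
  epsilon < G -> 0 < H ->
  H <= 1 \/ H <= 4 * L1 * gamma * (2 * tau1 ^+ 2 + 1) *
    ((2 + 2 * tau1) `^ beta * G `^ beta / (1 - tau1) `^ beta) ->
  8 * Lambda <= T * (gamma / H * G ^+ 2).
Proof.
move=> L0_gt0 L1_gt0 /andP[t1 t11] t2 /andP[b0 b1] e0 Lam0 T0 gE TL eG H0.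
set c := 2 * tau1 ^+ 2 + 1 in gE TL *.
have c0 : 0 < c by rewrite ltr_wpDl // mulr_ge0 // sqr_ge0.
have u0 : 0 < 1 - tau1 by rewrite subr_gt0.
set B := (2 * tau2 / (1 - tau1)) `^ beta in gE TL.
have B0 : 0 < B by rewrite powR_gt0 // divr_gt0 // mulr_gt0.
set K := (2 + 2 * tau1) `^ beta in TL *.
have K0 : 0 < K by rewrite powR_gt0 // ltr_wpDr // mulr_ge0.
set U := (1 - tau1) `^ beta in TL *.
have U0 : 0 < U by rewrite powR_gt0.
have E0 : 0 < epsilon `^ (2 - beta) by rewrite powR_gt0.
have G0 : 0 < G by exact: lt_trans eG.
have g0 : 0 < gamma.
  by rewrite gE !lt_min !divr_gt0 ?mulr_gt0 // sqrtr_gt0.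
move: TL; rewrite !(maxr_pMr _ _ (ltW Lam0)) !ge_max => /and3P[T1 T2 T3].
have {}T1 : 256 * Lambda ^+ 2 <= T * epsilon ^+ 4.
  move: T1; rewrite mulrA ler_pdivrMr ?exprn_gt0 //; apply: le_trans.
  by rewrite expr2 mulrCA.
have {}T2 : Lambda * (64 * L1 * c * K) <= T * (U * epsilon `^ (2 - beta)).
  by rewrite -ler_pdivrMr ?mulr_gt0 // -[_ / _]mulrA.
have {}T3 : Lambda * c * (64 * (L0 + L1) + 128 * L1 * B) <= T * epsilon ^+ 2.
  by rewrite -ler_pdivrMr ?exprn_gt0 // -[_ / _]mulrA -[Lambda * c * _]mulrA.
have e2G : epsilon ^+ 2 <= G ^+ 2 by rewrite ler_sqr ?nnegrE ltW.
case=> [H1|HK].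
  apply: (@le_trans _ _ (T * (gamma * epsilon ^+ 2))); last first.
    rewrite ler_wpM2l ?(ltW T0) // ler_pM ?sqr_ge0 ?(ltW g0) //.
    by rewrite ler_pdivlMr // ler_piMr // ltW.
  have LcB : 0 < Lambda * c * (L1 * B) by rewrite !mulr_gt0.
  have Lc0 : 0 < Lambda * c * L0 by rewrite !mulr_gt0.
  have Lc1 : 0 < Lambda * c * L1 by rewrite !mulr_gt0.
  rewrite mulrCA gE; set x := T * epsilon ^+ 2 in T3 *.
  have x0 : 0 < x by rewrite mulr_gt0 ?exprn_gt0.
  rewrite !(minr_pMl _ _ (ltW x0)) !le_min !mul1r !ler_pdivlMl ?mulr_gt0 ?sqrtr_gt0 //.
  (* The third candidate, [1 / Num.sqrt T], needs the quartic bound [T1]; the others follow from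
     [T3]. *)
  apply/and4P; split; [lra|lra| |lra].
  have s0 : 0 < Num.sqrt T by rewrite sqrtr_gt0.
  have sT : Num.sqrt T ^+ 2 = T by rewrite sqr_sqrtr // ltW.
  rewrite /x -[X in _ <= X * _]sT expr2 -mulrA ler_pM2l //.
  rewrite -(@ler_pXn2r _ 2) ?nnegrE ?mulr_ge0 ?(ltW e0) ?(ltW s0) ?(ltW Lam0) //.
  have -> : (Num.sqrt T * epsilon ^+ 2) ^+ 2 = T * epsilon ^+ 4.
    by rewrite -[in RHS]sT; ring.
  by have := sqr_ge0 Lambda; lra.
have Gb0 : 0 < G `^ beta by rewrite powR_gt0.
have P0 : 0 < 4 * L1 * c * K * G `^ beta by rewrite !mulr_gt0.
(* Here [gamma] cancels between the step and the bound on [H]. *)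
apply: (@le_trans _ _ (T * (G ^+ 2 * (U / (4 * L1 * c * K * G `^ beta))))); last first.
  apply: ler_wpM2l; first exact: ltW.
  rewrite [_ / _ * _]mulrC; apply: ler_wpM2l; first exact: sqr_ge0.
  rewrite ler_pdivlMr // mulrC mulrA ler_pdivrMr //.
  apply: le_trans (ler_wpM2r (ltW U0) HK) _.
  rewrite le_eqVlt; apply/orP; left; apply/eqP; field.
  by rewrite gt_eqF.
(* One factor G^beta cancels against the normalizer, which leaves the exponent [2 - beta] of the
   bound on [T]. *)
have GG : G ^+ 2 = G `^ (2 - beta) * G `^ beta.
  by rewrite -powRD ?subrK ?powR_mulrn ?(ltW G0) // (gt_eqF G0) implybT.
have eGb : epsilon `^ (2 - beta) <= G `^ (2 - beta).
  by rewrite ge0_ler_powR ?nnegrE ?(ltW e0) ?(ltW G0) ?(ltW eG) // subr_ge0; lra.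
rewrite GG [X in _ <= X](_ : _ =
    T * (U * G `^ (2 - beta)) / (4 * L1 * c * K)); last first.
  by field; rewrite !gt_eqF.
rewrite ler_pdivlMr ?mulr_gt0 //.
apply: le_trans (ler_wpM2l (ltW T0) (ler_wpM2l (ltW U0) eGb)).
apply: le_trans T2.
have : 0 < Lambda * L1 * c * K by rewrite !mulr_gt0.
lra.
Qed.

End scalar_inequalities.

(** The choice of [A] and [delta] makes the argument [y] at least [G] despite the error of the
    sampled norm [N], and [Gamma] is the [beta]-th root of the wanted coefficient. From above,
    either [G] dominates [tau2] and [y] is at most a multiple of [G], or the bound on [gamma] keeps
    the normalizer at 1. *)
Lemma normalizer_bounds {R : realType}
    (L1 c gamma beta tau1 tau2 Gamma G N : R) :
  0 < L1 -> 0 < c -> 0 < gamma -> 0 < beta <= 1 -> 0 <= tau1 < 1 -> 0 < tau2 ->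
  gamma <= 1 / (8 * L1 * c * (2 * tau2 / (1 - tau1)) `^ beta) ->
  Gamma = (4 * L1 * gamma * c) `^ (1 / beta) -> 0 <= G ->
  (1 - tau1) * G - tau2 <= N <= (1 + tau1) * G + tau2 ->
  let H := (Num.max 1 (Gamma * (1 / (1 - tau1) * N + tau2 / (1 - tau1)))) `^ beta in
  [/\ 1 <= H, 4 * L1 * gamma * c * G `^ beta <= H
    & H <= 1 \/ H <= 4 * L1 * gamma * c *
        ((2 + 2 * tau1) `^ beta * G `^ beta / (1 - tau1) `^ beta)].
Proof.
move=> L10 c0 g0 /andP[b0 b1] /andP[t1 t11] t2 gB GammaE G0 /andP[N1 N2] H.
have u0 : 0 < 1 - tau1 by rewrite subr_gt0.
set P := 4 * L1 * gamma * c in GammaE *.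
have P0 : 0 < P by rewrite !mulr_gt0.
have Gamma0 : 0 < Gamma by rewrite GammaE powR_gt0.
have GammaP : Gamma `^ beta = P.
  by rewrite GammaE -powRrM mul1r mulVf ?gt_eqF // powRr1 // ltW.
set y := 1 / (1 - tau1) * N + tau2 / (1 - tau1) in H *.
have yE : y = (N + tau2) / (1 - tau1) by rewrite /y div1r mulrC -mulrDl.
have Gy : G <= y by rewrite yE ler_pdivlMr //; lra.
have y0 : 0 <= y by exact: le_trans Gy.
have mono (r s : R) : 0 <= r -> r <= s -> r `^ beta <= s `^ beta.
  move=> r0 rs; rewrite ge0_ler_powR ?nnegrE // ?(ltW b0) //.
  exact: le_trans rs.
have Gy0 : 0 <= Gamma * y by rewrite mulr_ge0 // ltW.
have le1m : 1 <= Num.max 1 (Gamma * y) by rewrite le_max lexx.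
split.
- apply: (@le_trans _ _ (1 `^ beta)); first by rewrite powR1.
  exact: mono.
- rewrite -GammaP -powRM ?(ltW Gamma0) //; apply: mono.
    by rewrite mulr_ge0 // ltW.
  by rewrite le_max (ler_wpM2l (ltW Gamma0) Gy) orbT.
have [Gy1|Gy1] := leP (Gamma * y) 1.
  by left; rewrite /H max_l // powR1.
have HE : H = P * y `^ beta.
  by rewrite /H max_r ?(ltW Gy1) // powRM ?(ltW Gamma0) // GammaP.
(* The threshold makes [N + tau2] at most [2 * (1 + tau1) * G] in the first case and at most
   [4 * tau2] in the second. *)
have [cmp|cmp] := leP (2 * tau2) ((1 + tau1) * G).
  right; rewrite HE; apply: ler_wpM2l; first exact: ltW.
  have K0 : 0 <= 2 + 2 * tau1 by lra.
  rewrite ler_pdivlMr ?powR_gt0 // -!powRM ?(ltW u0) //.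
  apply: mono; first by rewrite mulr_ge0 // ltW.
  by rewrite yE divfK ?gt_eqF //; lra.
left; rewrite HE.
set B := 2 * tau2 / (1 - tau1) in gB.
have B0 : 0 < B by rewrite divr_gt0 // mulr_gt0.
have Bb0 : 0 < B `^ beta by rewrite powR_gt0.
have y2B : y <= 2 * B.
  by rewrite yE /B mulrA ler_pM2r ?invr_gt0 //; lra.
(* The factor 2, a bound for 2^beta as [beta <= 1], turns the coefficient 4 of [P] into the 8 of
   [gB]. *)
have yb : y `^ beta <= 2 * B `^ beta.
  apply: le_trans (mono _ _ y0 y2B) _; rewrite powRM ?(ltW B0) //.
  by rewrite ler_pM2r // ler1_powR // ler1n.
apply: le_trans (ler_wpM2l (ltW P0) yb) _.
move: gB; rewrite ler_pdivlMr ?mulr_gt0 // /P; lra.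
Qed.

(** * One step of the iteration *)

Section expectation_bound.
Context {R : realType} {dXi : measure_display} {Xi : measurableType dXi}
  (P : probability Xi R).

Lemma has_expectation_cst (r : R) : has_expectation P (cst r) r.
Proof.
split; first exact: finite_measure_integrable_cst.
exact: expectation_cst.
Qed.

Lemma has_expectationD (X Y : Xi -> R) (a b : R) :
  has_expectation P X a -> has_expectation P Y b ->
  has_expectation P (fun x => X x + Y x) (a + b).
Proof.
move=> [iX EX] [iY EY]; split; first exact: (integrableD _ iX iY).
move: EX EY; rewrite unlock => EX EY.
by rewrite EFinD -EX -EY -integralD.
Qed.

Lemma has_expectationZ (X : Xi -> R) (a k : R) :
  has_expectation P X a -> has_expectation P (fun x => k * X x) (k * a).
Proof.
move=> [iX EX]; split; first exact: (integrableZl _ k iX).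
by move: EX; rewrite unlock => EX; rewrite EFinM -EX -integralZl.
Qed.

Lemma has_expectation_sum (I : Type) (s : seq I) (X : I -> Xi -> R) (a : I -> R) :
  (forall i, has_expectation P (X i) (a i)) ->
  has_expectation P (fun x => \sum_(i <- s) X i x) (\sum_(i <- s) a i).
Proof.
move=> Xa; elim: s => [|i s IHs].
  under eq_fun do rewrite big_nil.
  by rewrite big_nil; exact: has_expectation_cst.
under eq_fun do rewrite big_cons.
by rewrite big_cons; exact: has_expectationD.
Qed.

(** [Y] dominates [X] only almost everywhere and may be negative on a null set, so the comparison
    passes through the absolute value of [Y], which equals [Y] almost everywhere. *)
Lemma ge0_integral_le_expectation (X Y : Xi -> R) (m : R) :
  measurable_fun setT X -> (forall x, 0 <= X x) ->
  has_expectation P Y m -> {ae P, forall x, X x <= Y x} ->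
  (\int[P]_x (X x)%:E <= m%:E)%E.
Proof.
move=> mX X0 [iY]; rewrite unlock => <- XY.
have mY : measurable_fun setT Y.
  exact/measurable_EFinP/(measurable_int _ iY).
apply: (@le_trans _ _ (\int[P]_x (`|Y x|%R)%:E)%E).
  apply: ae_ge0_le_integral.
  - exact: measurableT.
  - by move=> x _; rewrite lee_fin.
  - exact/measurable_EFinP.
  - by move=> x _; rewrite lee_fin.
  - exact/measurable_EFinP/measurableT_comp.
  - by apply: filterS XY => x h _; rewrite lee_fin (le_trans h) // ler_norm.
rewrite le_eqVlt; apply/orP; left; apply/eqP.
apply: ae_eq_integral => //.
- exact/measurable_EFinP/measurableT_comp.
- exact/measurable_EFinP.
- by apply: filterS XY => x h _; rewrite ger0_norm // (le_trans (X0 x)).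
Qed.
End expectation_bound.

Section one_step.
Context {R : realType} {d : nat} {dXi : measure_display}
  {Xi : measurableType dXi} (P : probability Xi R)
  (f : Xi -> 'rV[R]_d -> R) (F : 'rV[R]_d -> R) (L0 L1 alpha tau1 tau2 : R).
Hypotheses (f_diff : forall x w, differentiable (f x) w)
  (F_mean : forall w, has_expectation P (fun x => f x w) (F w))
  (F_smooth : generalized_smooth F L0 L1 alpha)
  (f_unbiased : unbiased_gradient P f F)
  (f_error : affine_approx_error P f F tau1 tau2).

Lemma measurable_sample (w : 'rV[R]_d) : measurable_fun setT (f^~ w).
Proof. by have [iF _] := F_mean w; exact/measurable_EFinP/(measurable_int _ iF). Qed.

Lemma continuous_objective : continuous F.
Proof. by move=> w; apply: differentiable_continuous; case: F_smooth. Qed.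

Lemma inf_le (w : 'rV[R]_d) : inf (range F) <= F w.
Proof. by case: F_smooth => _ lbF _ _ _; apply: ge_inf => //; exists w. Qed.

(** Descent lemma, then averaging over the sample. The quadratic term in the stochastic gradient is
    first replaced by an affine one, whose mean unbiasedness evaluates. *)
Lemma integral_step_le (w : 'rV[R]_d) (a G : R) : G = enorm (grad F w) ->
  (\int[P]_x (F (w - a *: grad (f x) w) - inf (range F))%:E <=
   (F w - inf (range F) + (- (a * G ^+ 2) +
      a ^+ 2 * (L0 + L1 * G `^ alpha) / 2 * (G ^+ 2 + (tau1 * G + tau2) ^+ 2)))%:E)%E.
Proof.
move=> ->; move: G => _; set G := enorm (grad F w).
have [dF _ [L0_gt0 L1_gt0] _ smooth] := F_smooth.
have [/andP[t1 _] t2 err] := f_error.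
have G0 : 0 <= G by exact: enorm_ge0.
set L := L0 + L1 * G `^ alpha.
have L_ge0 : 0 <= L by rewrite addr_ge0 ?mulr_ge0 ?powR_ge0 // ltW.
(* q is affine in the stochastic gradient, hence has a known expectation. *)
pose q x := (F w - inf (range F) + L / 2 * a ^+ 2 * ((tau1 * G + tau2) ^+ 2 - G ^+ 2))
  + (a ^+ 2 * L - a) * dotr (grad F w) (grad (f x) w).
have qE : has_expectation P q
    ((F w - inf (range F) + L / 2 * a ^+ 2 * ((tau1 * G + tau2) ^+ 2 - G ^+ 2))
      + (a ^+ 2 * L - a) * dotr (grad F w) (grad F w)).
  apply: has_expectationD; first exact: has_expectation_cst.
  apply: has_expectationZ; apply: has_expectation_sum => i.
  exact: has_expectationZ.
have mstep : measurable_fun setT (fun x => F (w - a *: grad (f x) w) - inf (range F)).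
  apply: measurable_funB; last exact: measurable_cst.
  apply: (@measurable_caratheodory _ _ _ _ _ _ (fun _ : Xi => F) id) => //.
    by move=> _; exact: continuous_objective.
  move=> i; under eq_fun do rewrite !mxE.
  apply: measurable_funB; first exact: measurable_cst.
  apply: measurable_funM; first exact: measurable_cst.
  have := @measurable_grad _ _ _ _ _ _ f id (cst w) i measurable_sample f_diff.
  under [X in _ -> _ -> measurable_fun _ X]eq_fun do rewrite mxE.
  by apply=> // j; exact: measurable_cst.
apply: le_trans (ge0_integral_le_expectation mstep _ qE _) _.
- by move=> x; rewrite subr_ge0 inf_le.
- apply: filterS (err w) => x.
  set n := grad (f x) w => nerr.
  have := @descent_lemma _ _ F dF L w (- (a *: n)) (fun w' => smooth w' w).
  rewrite enormN enormZ exprMn real_normK ?num_real // sqr_enorm !dotrE.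
  have : dotr n n <= (tau1 * G + tau2) ^+ 2 + 2 * dotr (grad F w) n - G ^+ 2.
    (* Expanding the squared error bound leaves a cross term that is linear in [n]. *)
    have : enorm (n - grad F w) ^+ 2 <= (tau1 * G + tau2) ^+ 2.
      rewrite ler_sqr ?nnegrE ?enorm_ge0 // addr_ge0 ?(ltW t2) //.
      by rewrite mulr_ge0.
    by rewrite !sqr_enorm !dotrE (dotrC n); lra.
  have La : 0 <= L / 2 * a ^+ 2 by rewrite mulr_ge0 ?sqr_ge0 // divr_ge0.
  move=> /(ler_wpM2l La) h1 h2; rewrite /q; lra.
- by rewrite lee_fin -sqr_enorm -/G -/L; lra.
Qed.
End one_step.

(** * Measurability of the iterates *)

Section iterates.
Context {R : realType} {d : nat} {dXi : measure_display}
  {Xi : measurableType dXi} (f : Xi -> 'rV[R]_d -> R)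
  (gamma beta A delta Gamma : R) (w0 : 'rV[R]_d).
Hypotheses (f_diff : forall x w, differentiable (f x) w)
  (mf : forall w, measurable_fun setT (f^~ w)).

Lemma measurable_ian_sgd_step (dO : measure_display) (Om : measurableType dO)
    (W : Om -> 'rV[R]_d) (X X' : Om -> Xi) :
  (forall i, measurable_fun setT (fun y => W y 0 i)) ->
  measurable_fun setT X -> measurable_fun setT X' ->
  forall i, measurable_fun setT (fun y =>
    ian_sgd_step f gamma beta A delta Gamma (W y) (X y) (X' y) 0 i).
Proof.
move=> mW mX mX' i.
rewrite (_ : (fun y => _) = fun y => W y 0 i - gamma /
    Num.max 1 (Gamma * (A * enorm (grad (f (X' y)) (W y)) + delta)) `^ beta *
    grad (f (X y)) (W y) 0 i); last first.
  by apply/funext => y; rewrite /ian_sgd_step !mxE.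
apply: measurable_funB => //; apply: measurable_funM; last exact: measurable_grad.
apply: measurable_funM; first exact: measurable_cst.
under eq_fun do rewrite -powRN.
apply: (measurableT_comp (measurable_powR _)).
apply: measurable_maxr; first exact: measurable_cst.
apply: measurable_funM; first exact: measurable_cst.
apply: measurable_funD; last exact: measurable_cst.
apply: measurable_funM; first exact: measurable_cst.
by apply: measurable_enorm => j; exact: measurable_grad.
Qed.

(** [Om] is arbitrary and only the samples before [t] enter. Taken over [sigma_of], this says that
    the iterate is a function of the past; over [Omega], that it is a random variable. *)
Lemma measurable_ian_sgd (dO : measure_display) (Om : measurableType dO)
    (X X' : nat -> Om -> Xi) (t : nat) :
  (forall s, (s < t)%N -> measurable_fun setT (X s)) ->
  (forall s, (s < t)%N -> measurable_fun setT (X' s)) ->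
  forall i, measurable_fun setT (fun y =>
    ian_sgd f gamma beta A delta Gamma w0 (X^~ y) (X'^~ y) t 0 i).
Proof.
elim: t => [|t IHt] mX mX'; first by move=> i; exact: measurable_cst.
apply: measurable_ian_sgd_step; [|exact: mX|exact: mX'].
by apply: IHt => s st; [apply: mX|apply: mX']; exact: ltnW.
Qed.
End iterates.

(** * Averaging over the two fresh samples of an iteration *)

Section two_samples.
Context {R : realType} {d : nat} {dO dXi : measure_display}
  {Omega : measurableType dO} {Xi : measurableType dXi}
  (Pr : probability Omega R) (P : probability Xi R)
  (I : finType) (X : I -> {RV Pr >-> Xi}) (J : {set I}) (k k' : I)
  (f : Xi -> 'rV[R]_d -> R) (F : 'rV[R]_d -> R) (L0 L1 alpha tau1 tau2 : R).
Hypotheses (indep : mutually_independent X)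
  (k'J : k' \notin J) (kJ : k \notin k' |: J)
  (lawk : forall B, measurable B -> distribution Pr (X k) B = P B)
  (lawk' : forall B, measurable B -> distribution Pr (X k') B = P B)
  (f_diff : forall x w, differentiable (f x) w)
  (F_mean : forall w, has_expectation P (fun x => f x w) (F w))
  (F_smooth : generalized_smooth F L0 L1 alpha)
  (f_error : affine_approx_error P f F tau1 tau2).

Let mf := measurable_sample F_mean.

Let small_error w x :=
  enorm (grad (f x) w - grad F w) <= tau1 * enorm (grad F w) + tau2.

Lemma measurable_grad_objective (dY : measure_display) (Y : measurableType dY)
    (W : Y -> 'rV[R]_d) (i : 'I_d) :
  (forall i, measurable_fun setT (fun y => W y 0 i)) ->
  measurable_fun setT (fun y => grad F (W y) 0 i).
Proof.
move=> mW; case: F_smooth => dF _ _ _ _.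
exact: (@measurable_grad _ _ _ _ _ _ (fun _ : Y => F) id).
Qed.

Lemma measurable_objective (dY : measure_display) (Y : measurableType dY)
    (W : Y -> 'rV[R]_d) :
  (forall i, measurable_fun setT (fun y => W y 0 i)) ->
  measurable_fun setT (fun y => F (W y)).
Proof.
move=> mW; apply: (@measurable_caratheodory _ _ _ _ _ _ (fun _ : Y => F) id) => //.
by move=> _; exact: continuous_objective F_smooth.
Qed.

(** The error condition holds almost surely for each fixed [w]. As [W] is a function of the samples
    in [J] and [X k'] is independent of them, the probability of the bad event is a mean of
    probabilities of null sections. *)
Lemma small_error_ae (W : Omega -> 'rV[R]_d) :
  (forall i, measurable_fun setT (fun y : sigma_of X J => W y 0 i)) ->
  {ae Pr, forall y, small_error (W y) (X k' y)}.
Proof.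
move=> mW.
pose S := (sigma_of X J * Xi)%type.
pose bad : set S := [set z | ~~ small_error (W z.1) z.2].
have mW1 i : measurable_fun setT (fun z : S => W z.1 0 i).
  exact: (measurableT_comp (mW i) measurable_fst).
have mbad : measurable bad.
  suff mb : measurable_fun setT (fun z : S => ~~ small_error (W z.1) z.2).
    by rewrite -[bad]setTI; exact: (mb measurableT [set true]).
  apply: measurable_neg; apply: measurable_fun_ler.
    apply: measurable_enorm => i; under eq_fun do rewrite !mxE.
    apply: measurable_funB; last first.
      have := measurable_grad_objective i mW1.
      by under eq_fun do rewrite mxE.
    have := @measurable_grad _ _ _ _ _ _ f snd (fun z : S => W z.1) i
      mf f_diff measurable_snd mW1.
    by under eq_fun do rewrite mxE.
  apply: measurable_funD; last exact: measurable_cst.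
  apply: measurable_funM; first exact: measurable_cst.
  by apply: measurable_enorm => i; exact: measurable_grad_objective.
have mpair : measurable_fun [set: Omega] (fun y => (y : sigma_of X J, X k' y)).
  apply: (@measurable_fun_pair _ _ _ Omega (sigma_of X J) Xi) => //.
  exact: measurable_to_sigma_of.
have mind : measurable_fun setT (fun z : S => (\1_bad z : R)%:E).
  exact/measurable_EFinP/measurable_indic.
have := @integral_indep _ _ _ _ _ _ _ _ indep J k' P _ k'J lawk' mind _.
rewrite [X in _ -> _ = X]integral0_eq => [int0|y _]; last first.
  rewrite (ae_eq_integral (cst 0)%E) ?integral0 //.
    exact: (measurableT_comp mind (measurable_pair1 _)).
  case: f_error => _ _ /(_ (W y)); apply: filterS => x err _ /=.
  by rewrite indicE memNset //= /bad /= /small_error err.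
have mcomp : measurable_fun [set: Omega]
    (fun y : Omega => (\1_bad (y : sigma_of X J, X k' y) : R)%:E).
  exact: (measurableT_comp mind mpair).
have /(ae_eq_integral_abs Pr measurableT mcomp) :
    (\int[Pr]_y `|(\1_bad (y : sigma_of X J, X k' y) : R)%:E|)%E = 0%E.
  rewrite -[RHS]int0; last by move=> z; rewrite lee_fin.
  by apply: eq_integral => y _; rewrite gee0_abs // lee_fin.
apply: filterS => y /(_ Logic.I) /=.
rewrite indicE => /eqP; apply: contraLR => err.
by rewrite mem_set //= eqe oner_eq0.
Qed.

(** The sample [k'] fixes the normalizer and is kept frozen: the bound holds for every [x'] with
    small error, hence almost surely. Only nonnegative terms are added, so the inequality makes
    sense before the integrals are known to be finite. *)
Lemma two_sample_step (W : Omega -> 'rV[R]_d)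
    (stp : 'rV[R]_d -> Xi -> Xi -> 'rV[R]_d) (phi : 'rV[R]_d -> R) (C : R) :
  (forall i, measurable_fun setT (fun y => W y 0 i)) ->
  (forall i, measurable_fun setT (fun y : sigma_of X J => W y 0 i)) ->
  (forall i, measurable_fun setT (fun z : sigma_of X (k' |: J) * Xi =>
     stp (W z.1) z.2 (X k' z.1) 0 i)) ->
  measurable_fun setT (fun y => phi (W y)) -> (forall w, 0 <= phi w) -> 0 <= C ->
  (forall w x', small_error w x' ->
    (\int[P]_x (F (stp w x x') - inf (range F))%:E + (phi w)%:E <=
      (F w - inf (range F))%:E + C%:E)%E) ->
  (\int[Pr]_y (F (stp (W y) (X k y) (X k' y)) - inf (range F))%:E +
     \int[Pr]_y (phi (W y))%:E <=
   \int[Pr]_y (F (W y) - inf (range F))%:E + C%:E)%E.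
Proof.
move=> mW mWJ mstp mphi phi0 C0 bound.
have gap0 w : 0 <= F w - inf (range F) by rewrite subr_ge0 (inf_le F_smooth).
pose U (z : sigma_of X (k' |: J) * Xi) :=
  (F (stp (W z.1) z.2 (X k' z.1)) - inf (range F))%:E.
have mU : measurable_fun setT U.
  apply/measurable_EFinP; apply: measurable_funB; last exact: measurable_cst.
  exact: measurable_objective.
have U0 z : (0 <= U z)%E by rewrite lee_fin.
(* First average over X k, which is independent of (W, X k'). *)
have -> := @integral_indep _ _ _ _ _ _ _ _ indep _ k P _ kJ lawk mU U0.
have mFU : measurable_fun [set: Omega] (fubini_F P U).
  exact: (measurableT_comp
    (@measurable_fun_fubini_tonelli_F _ _ _ _ _ P _ mU U0)
    (@measurable_to_sigma_of _ _ _ _ _ _ _ X (k' |: J))).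
have mV : measurable_fun [set: Omega] (fun y => (F (W y) - inf (range F))%:E).
  apply/measurable_EFinP; apply: measurable_funB; last exact: measurable_cst.
  exact: measurable_objective.
rewrite -[X in (_ + X <= _)%E]/(\int[Pr]_y (phi (W y))%:E)%E.
rewrite -ge0_integralD //; first last.
- exact/measurable_EFinP.
- by move=> y _; rewrite lee_fin.
- by move=> y _; apply: integral_ge0.
have -> : C%:E = (\int[Pr]_y (cst C%:E y))%E.
  by have := expectation_cst Pr C; rewrite unlock.
rewrite -ge0_integralD //; last by move=> y _; rewrite lee_fin.
apply: ae_ge0_le_integral => //.
- by move=> y _; apply: adde_ge0; [exact: integral_ge0|rewrite lee_fin].
- by apply: emeasurable_funD => //; exact/measurable_EFinP.
- by move=> y _; apply: adde_ge0; rewrite lee_fin.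
- by apply: emeasurable_funD => //; exact: measurable_cst.
- by apply: filterS (small_error_ae mWJ) => y /bound.
Qed.
End two_samples.

(** Combines the mean bound for a fixed step with the estimates on step size and normalizer. The
    gain [2 * Lambda / T] is a quarter of the progress [8 * Lambda / T] made while the gradient
    exceeds [epsilon], the quarter that [step_decrease] leaves. *)
Lemma expected_decrease (R : realType) (d : nat)
  (dXi : measure_display) (Xi : measurableType dXi) (P : probability Xi R)
  (f : Xi -> 'rV[R]_d -> R) (F : 'rV[R]_d -> R)
  (L0 L1 alpha tau1 tau2 beta epsilon gamma A delta Gamma Lambda T : R)
  (f_diff : forall x w, differentiable (f x) w)
  (F_mean : forall w, has_expectation P (fun x => f x w) (F w))
  (F_smooth : generalized_smooth F L0 L1 alpha)
  (f_unbiased : unbiased_gradient P f F)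
  (f_error : affine_approx_error P f F tau1 tau2)
  (beta_range : alpha <= beta <= 1) (beta_gt0 : 0 < beta)
  (epsilon_gt0 : 0 < epsilon) (Lambda_gt0 : 0 < Lambda) (T_gt0 : 0 < T)
  (gammaE : gamma =
     Num.min (1 / (4 * L0 * (2 * tau1 ^+ 2 + 1)))
    (Num.min (1 / (4 * L1 * (2 * tau1 ^+ 2 + 1)))
    (Num.min (1 / Num.sqrt T)
             (1 / (8 * L1 * (2 * tau1 ^+ 2 + 1) *
                   (2 * tau2 / (1 - tau1)) `^ beta)))))
  (AE : A = 1 / (1 - tau1))
  (deltaE : delta = tau2 / (1 - tau1))
  (GammaE : Gamma = (4 * L1 * gamma * (2 * tau1 ^+ 2 + 1)) `^ (1 / beta))
  (T_large : Lambda *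
     Num.max (256 * Lambda / epsilon ^+ 4)
    (Num.max (64 * L1 * (2 * tau1 ^+ 2 + 1) * (2 + 2 * tau1) `^ beta /
                ((1 - tau1) `^ beta * epsilon `^ (2 - beta)))
             ((2 * tau1 ^+ 2 + 1) *
                ((64 * (L0 + L1) + 128 * L1 * (2 * tau2 / (1 - tau1)) `^ beta) /
                 epsilon ^+ 2)))
     <= T) (w : 'rV[R]_d) (x' : Xi) :
  enorm (grad (f x') w - grad F w) <= tau1 * enorm (grad F w) + tau2 ->
  (\int[P]_x (F (ian_sgd_step f gamma beta A delta Gamma w x x') -
      inf (range F))%:E +
    (2 * Lambda / T * (epsilon < enorm (grad F w))%R%:R)%:E <=
   (F w - inf (range F))%:E +
     (1 / 2 * (L0 + L1) * (1 + 4 * tau2 ^+ 2) ^+ 2 * gamma ^+ 2)%:E)%E.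
Proof.
move=> small; have [_ _ [L0_gt0 L1_gt0] /andP[alpha0 _] _] := F_smooth.
have [t1 t2 _] := f_error; have [t1_ge0 t1_lt1] := andP t1.
have [ab b1] := andP beta_range.
set G := enorm (grad F w) in small *.
have G0 : 0 <= G by exact: enorm_ge0.
set N := enorm (grad (f x') w).
have N_range : (1 - tau1) * G - tau2 <= N <= (1 + tau1) * G + tau2.
  have h1 := le_trans (ler_enormB (grad (f x') w) (grad F w)) small.
  have h2 := ler_enormB (grad F w) (grad (f x') w).
  rewrite -[enorm (grad F w - _)]enormN opprB -/N -/G in h2.
  have h3 := le_trans h2 small.
  by move: h1 h3; rewrite -/N -/G; lra.
set c := 2 * tau1 ^+ 2 + 1 in gammaE GammaE T_large.
have c0 : 0 < c by rewrite ltr_wpDl // mulr_ge0 // sqr_ge0.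
have u0 : 0 < 1 - tau1 by rewrite subr_gt0.
have B0 : 0 < (2 * tau2 / (1 - tau1)) `^ beta.
  by rewrite powR_gt0 // divr_gt0 // mulr_gt0.
have g0 : 0 < gamma.
  by rewrite gammaE !lt_min !divr_gt0 ?mulr_gt0 // sqrtr_gt0.
(* Splits the minimum defining [gamma] into its four upper bounds. *)
have : gamma <= gamma by [].
rewrite {2}gammaE !le_min => /and4P[gL0 gL1 _ gB].
have brange : 0 < beta <= 1 by rewrite beta_gt0.
have [H1 HG Hup] :=
  normalizer_bounds L1_gt0 c0 g0 brange t1 t2 gB GammaE G0 N_range.
rewrite -AE -deltaE in H1 HG Hup.
set H := _ `^ beta in H1 HG Hup.
have H0 : 0 < H by exact: lt_le_trans H1.
have := integral_step_le f_diff F_mean F_smooth f_unbiased f_error (gamma / H)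
  (erefl G).
rewrite /ian_sgd_step -/N -/H => bound.
apply: le_trans (leeD2r _ bound) _; rewrite -!EFinD lee_fin.
have arange : 0 <= alpha <= beta by rewrite alpha0.
have := step_decrease tau2 L0_gt0 L1_gt0 t1_ge0 arange b1 g0 gL0 gL1 G0 H1 HG.
have aG0 : 0 <= gamma / H * G ^+ 2.
  by rewrite mulr_ge0 ?sqr_ge0 // divr_ge0 // ltW.
have progress : 2 * Lambda / T * (epsilon < G)%R%:R <= gamma / H * G ^+ 2 / 4.
  have [eG|_] := ltP epsilon G; last by rewrite mulr0 divr_ge0.
  have := step_progress L0_gt0 L1_gt0 t1 t2 brange epsilon_gt0 Lambda_gt0
    T_gt0 gammaE T_large eG H0 Hup.
  rewrite mulr1 ler_pdivrMr //; lra.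
move: progress; rewrite -/c; lra.
Qed.

(** * Summation over the iterations and probability of failure *)

Theorem theorem2 (R : realType) (d : nat)
  (dXi : measure_display) (Xi : measurableType dXi) (P : probability Xi R)
  (f : Xi -> 'rV[R]_d -> R) (F : 'rV[R]_d -> R)
  (L0 L1 alpha tau1 tau2 beta epsilon : R) (T : nat) (w0 : 'rV[R]_d)
  (gamma A delta Gamma Fstar Lambda : R)
  (dO : measure_display) (Omega : measurableType dO) (Pr : probability Omega R)
  (xi xi' : nat -> {RV Pr >-> Xi})
  (f_diff : forall x w, differentiable (f x) w)
  (F_mean : forall w, has_expectation P (fun x => f x w) (F w))
  (F_smooth : generalized_smooth F L0 L1 alpha)
  (f_unbiased : unbiased_gradient P f F)
  (f_error : affine_approx_error P f F tau1 tau2)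
  (beta_range : alpha <= beta <= 1) (beta_gt0 : 0 < beta)
  (epsilon_gt0 : 0 < epsilon)
  (gammaE : gamma =
     Num.min (1 / (4 * L0 * (2 * tau1 ^+ 2 + 1)))
    (Num.min (1 / (4 * L1 * (2 * tau1 ^+ 2 + 1)))
    (Num.min (1 / Num.sqrt T%:R)
             (1 / (8 * L1 * (2 * tau1 ^+ 2 + 1) *
                   (2 * tau2 / (1 - tau1)) `^ beta)))))
  (AE : A = 1 / (1 - tau1))
  (deltaE : delta = tau2 / (1 - tau1))
  (GammaE : Gamma = (4 * L1 * gamma * (2 * tau1 ^+ 2 + 1)) `^ (1 / beta))
  (FstarE : Fstar = inf (range F))
  (LambdaE : Lambda =
     F w0 - Fstar + 1 / 2 * (L0 + L1) * (1 + 4 * tau2 ^+ 2) ^+ 2)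
  (samples : iid_sample_pairs P T xi xi')
  (T_large : Lambda *
     Num.max (256 * Lambda / epsilon ^+ 4)
    (Num.max (64 * L1 * (2 * tau1 ^+ 2 + 1) * (2 + 2 * tau1) `^ beta /
                ((1 - tau1) `^ beta * epsilon `^ (2 - beta)))
             ((2 * tau1 ^+ 2 + 1) *
                ((64 * (L0 + L1) + 128 * L1 * (2 * tau2 / (1 - tau1)) `^ beta) /
                 epsilon ^+ 2)))
     <= T%:R) :
  let w (t : nat) (omega : Omega) :=
    ian_sgd f gamma beta A delta Gamma w0 (xi^~ omega) (xi'^~ omega) t in
  let success := [set omega |
    \big[Num.min/enorm (grad F (w 0%N omega))]_(t < T.+1)
       enorm (grad F (w t omega)) <= epsilon] in
  measurable success /\ ((1 / 2)%:E <= Pr success)%E.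
Proof.
move=> w success.
have [_ _ [L0_gt0 L1_gt0] _ _] := F_smooth.
have [t1 t2_gt0 _] := f_error; have [t1_ge0 t1_lt1] := andP t1.
have mf := measurable_sample F_mean.
set C := 1 / 2 * (L0 + L1) * (1 + 4 * tau2 ^+ 2) ^+ 2 in LambdaE.
have C_gt0 : 0 < C.
  apply: mulr_gt0; first by lra.
  by rewrite exprn_gt0 // ltr_pwDl // mulr_ge0 // sqr_ge0.
have gap0 v : 0 <= F v - Fstar by rewrite FstarE subr_ge0 (inf_le F_smooth).
have Lambda_gt0 : 0 < Lambda by rewrite LambdaE ltr_wpDl.
(* A zero [T] is excluded, since the left side of [T_large] is positive. *)
have T_gt0 : (0 : R) < T%:R.
  apply: lt_le_trans T_large; rewrite mulr_gt0 // lt_max.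
  by rewrite divr_gt0 ?mulr_gt0 ?exprn_gt0.
have gamma_gt0 : 0 < gamma.
  have c_gt0 : 0 < 2 * tau1 ^+ 2 + 1 by rewrite ltr_wpDl // mulr_ge0 // sqr_ge0.
  rewrite gammaE !lt_min !divr_gt0 ?mulr_gt0 ?sqrtr_gt0 //.
  by rewrite powR_gt0 // divr_gt0 ?mulr_gt0 // subr_gt0.
have g2T : gamma ^+ 2 * T%:R <= 1.
  have s0 : 0 < Num.sqrt (T%:R : R) by rewrite sqrtr_gt0.
  have : gamma <= 1 / Num.sqrt T%:R by rewrite gammaE !ge_min lexx !orbT.
  rewrite ler_pdivlMr // => gs.
  have -> : gamma ^+ 2 * T%:R = (gamma * Num.sqrt T%:R) ^+ 2.
    by rewrite exprMn sqr_sqrtr // ltW.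
  by rewrite exprn_ile1 // mulr_ge0 // ltW.
have mw t i : measurable_fun setT (fun y => w t y 0 i).
  exact: measurable_ian_sgd.
have mG t : measurable_fun setT (fun y => enorm (grad F (w t y))).
  by apply: measurable_enorm => i; exact: (measurable_grad_objective F_smooth).
(* The default value of the iterated minimum is the term at [t = 0], so the minimum is that over the
   [T + 1] iterates with index 0 to [T]. *)
pose fail := [set y | epsilon <
  \big[Num.min/enorm (grad F (w 0%N y))]_(t < T.+1) enorm (grad F (w t y))].
have failE : fail = \bigcap_(t in [set: 'I_T.+1])
    [set y | epsilon < enorm (grad F (w t y))].
  apply/seteqP; split=> y.
    by move=> /bigmin_gtP[_ h] t _; exact: h.
  move=> h; apply/bigmin_gtP; split=> [|t _]; last exact: h.
  exact: (h ord0).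
have mbig t : measurable [set y | epsilon < enorm (grad F (w t y))].
  have mb := measurable_fun_ltr (measurable_cst epsilon) (mG t).
  by have := mb measurableT [set true] Logic.I; rewrite setTI.
have mfail : measurable fail by rewrite failE; exact: fin_bigcap_measurable.
have successE : success = ~` fail.
  by apply/seteqP; split=> y /=; rewrite /success /fail /= leNgt => /negP.
rewrite successE; split; first exact: measurableC.
have fin_fail : Pr fail \is a fin_num by exact: fin_num_measure.
pose p := fine (Pr fail).
have pE : Pr fail = p%:E by rewrite fineK.
pose e t := (\int[Pr]_y (F (w t y) - Fstar)%:E)%E.
have step t : (t < T)%N ->
    (e t.+1 + (2 * Lambda / T%:R * p)%:E <= e t + (C * gamma ^+ 2)%:E)%E.
  move=> tT.
  pose phi v := 2 * Lambda / T%:R * (epsilon < enorm (grad F v))%R%:R.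
  have q0 : 0 <= 2 * Lambda / T%:R by rewrite divr_ge0 ?mulr_ge0 // ltW.
  have phi0 v : 0 <= phi v by rewrite mulr_ge0.
  have phiE t' : (fun y => phi (w t' y)) =
      (fun y => 2 * Lambda / T%:R * \1_[set y | epsilon < enorm (grad F (w t' y))] y).
    apply/funext => y; rewrite /phi indicE; congr (_ * _%:R); congr nat_of_bool.
    by apply/idP/idP => [h|]; [rewrite inE|rewrite inE].
  have mphi : measurable_fun setT (fun y => phi (w t y)).
    rewrite phiE; apply: measurable_funM; first exact: measurable_cst.
    exact: measurable_indic.
  (* For every [t < T], [fail] lies in the event that the gradient at [t] exceeds [epsilon]; this
     gives one probability [p] for all iterations. *)
  have int_phi : ((2 * Lambda / T%:R * p)%:E <= \int[Pr]_y (phi (w t y))%:E)%E.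
    have -> : (2 * Lambda / T%:R * p)%:E =
        (\int[Pr]_y ((2 * Lambda / T%:R)%:E * (\1_fail y)%:E))%E.
      rewrite ge0_integralZl ?lee_fin //.
        by rewrite EFinM -pE integral_indic // setIT.
      exact/measurable_EFinP/measurable_indic.
    apply: ge0_le_integral => //.
    - by move=> y _; rewrite -EFinM lee_fin mulr_ge0.
    - apply: emeasurable_funM; first exact: measurable_cst.
      exact/measurable_EFinP/measurable_indic.
    - exact/measurable_EFinP.
    - move=> y _; rewrite -EFinM lee_fin; apply: ler_wpM2l => //.
      rewrite indicE; have [|_] := boolP (y \in fail); last by [].
      rewrite inE => /bigmin_gtP[_].
      by move=> /(_ (widen_ord (leqW (leqnn T)) (Ordinal tT)) isT) /= ->.
  apply: le_trans (leeD2l _ int_phi) _.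
  have [law law' indep] := samples.
  pose X (i : 'I_T * bool) := if i.2 then xi' i.1 else xi i.1.
  (* [J] indexes the samples of the iterations before [t]; the flag [true] marks the sample [xi'] of
     the normalizer. *)
  pose J := [set i : 'I_T * bool | (i.1 < t)%N]%SET.
  have mXJ (K : {set 'I_T * bool}) : J \subset K -> forall s (b : bool), (s < t)%N ->
      measurable_fun setT ((if b then xi' s else xi s) : sigma_of X K -> Xi).
    move=> JK s b st; have sT := ltn_trans st tT.
    have iK : (Ordinal sT, b) \in K by apply: (fintype.subsetP JK); rewrite inE.
    exact: (@measurable_fun_sigma_of _ _ _ _ _ _ _ X K _ iK).
  have mwK (K : {set 'I_T * bool}) : J \subset K -> forall i,
      measurable_fun setT (fun y : sigma_of X K => w t y 0 i).
    move=> JK; apply: measurable_ian_sgd => // s st.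
      exact: (mXJ K JK s false st).
    exact: (mXJ K JK s true st).
  rewrite /e FstarE.
  pose k := (Ordinal tT, false); pose k' := (Ordinal tT, true).
  have k'J : k' \notin J by rewrite inE ltnn.
  have kJ : k \notin k' |: J by rewrite !inE ltnn orbF xpair_eqE andbF.
  apply: (two_sample_step (X := X) (J := J) (k := k) (k' := k') indep k'J kJ
    (law t tT) (law' t tT) f_diff F_mean F_smooth f_error (mw t) (mwK J (subxx J))
    (stp := ian_sgd_step f gamma beta A delta Gamma)) => //.
  (* The step is jointly measurable in the fresh sample [X k] and in the samples of [k' |: J], the
     past together with the normalizer sample. *)
  - have JK : J \subset k' |: J by exact: finset.subsetUr.
    apply: measurable_ian_sgd_step => //.
    + move=> i; exact: (measurableT_comp (mwK _ JK i) measurable_fst).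
    + have mk' := measurable_fun_sigma_of (finset.setU11 k' J) (X := X).
      exact: (measurableT_comp mk' measurable_fst).
  - by rewrite mulr_ge0 ?sqr_ge0 // ltW.
  - move=> v x'.
    exact: (expected_decrease f_diff F_mean F_smooth f_unbiased f_error beta_range
      beta_gt0 epsilon_gt0 Lambda_gt0 T_gt0 gammaE AE deltaE GammaE T_large).
(* Telescoping, in additive form: [e t] might a priori be infinite, so nothing is subtracted. *)
have sum t : (t <= T)%N -> (e t + (t%:R * (2 * Lambda / T%:R * p))%:E <=
    (F w0 - Fstar + t%:R * (C * gamma ^+ 2))%:E)%E.
  elim: t => [_|t IHt tT].
    rewrite !mul0r !addr0 /e /=.
    by have := expectation_cst Pr (F w0 - Fstar); rewrite unlock => ->.
  rewrite (_ : t.+1%:R * _ = 2 * Lambda / T%:R * p + t%:R * (2 * Lambda / T%:R * p));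
    last by rewrite -natr1; ring.
  rewrite EFinD addeA.
  apply: le_trans (leeD2r _ (step t tT)) _; rewrite addeAC.
  apply: le_trans (leeD2r _ (IHt (ltnW tT))) _.
  by rewrite -EFinD lee_fin -natr1; lra.
have eT0 : (0 <= e T)%E by apply: integral_ge0 => y _; rewrite lee_fin.
have := le_trans (leeD2r _ eT0) (sum T (leqnn T)).
rewrite add0e lee_fin => main.
(* By [g2T] the accumulated noise is at most [C], and [Lambda] is the initial gap plus [C]. *)
have : 2 * Lambda * p <= Lambda.
  have h1 : T%:R * (2 * Lambda / T%:R * p) = 2 * Lambda * p.
    by field; rewrite gt_eqF.
  have h2 : T%:R * (C * gamma ^+ 2) <= C.
    by have := ler_wpM2l (ltW C_gt0) g2T; lra.
  move: main; rewrite h1 LambdaE; lra.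
move=> h; rewrite probability_setC // pE -EFinB lee_fin.
have : p <= 1 / 2 by rewrite -(ler_pM2l Lambda_gt0); lra.
lra.
Qed.
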